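(* Let $f(\xi)\in\mathbb{Z}_p[\xi_1,\ldots,\xi_n]$ be a quasielliptic polynomial of degree $d$ with respect to $\boldsymbol{w}=(w_1,\ldots,w_n)$, and let $\Xi(\xi)=\sum_{i=1}^{n}|\xi_i|_p^{d/w_i}$. Then there exist positive constants $A_0,A_1$ such that $$A_0\,\Xi(\xi)\leq |f(\xi)|_p\leq A_1\,\Xi(\xi)\quad\text{for any }\xi\in\mathbb{Q}_p^n.$$
   Context: $p$ is a prime, $\mathbb{Q}_p$ is the field of $p$-adic numbers, $\mathbb{Z}_p$ its ring of integers, and $|\cdot|_p=p^{-\mathrm{ord}(\cdot)}$. A non-constant polynomial $f(\xi)\in\mathbb{Q}_p[\xi_1,\ldots,\xi_n]$ is called quasielliptic of degree $d$ with respect to $\boldsymbol{w}=(w_1,\ldots,w_n)\in(\mathbb{N}\setminus\{0\})^n$ if: (Q1) $f(\lambda^{w_1}\xi_1,\ldots,\lambda^{w_n}\xi_n)=\lambda^d f(\xi)$ for all $\lambda\in\mathbb{Q}_p^\times$; and (Q2) $f(\xi_1,\ldots,\xi_n)=0\Leftrightarrow \xi_1=\cdots=\xi_n=0$. By convention all quasielliptic polynomials are assumed to have coefficients in $\mathbb{Z}_p$. *)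

(* Defs.v *)
From HB Require Import structures.
From mathcomp Require Import all_boot all_order all_algebra.
From mathcomp Require Import boolp classical_sets reals exp.
From mathcomp Require Import mpoly.

Set Implicit Arguments.
Unset Strict Implicit.
Unset Printing Implicit Defensive.

Import Order.TTheory GRing.Theory Num.Theory.
Local Open Scope ring_scope.

(* Z_p as the inverse limit of the rings Z/p^n.  An element x is encoded by   *)
(* the sequence (x mod p^n)_n of its canonical residues; the single equation  *)
(* of [coherent] says both that x n lies in [0, p^n[ and that x n.+1 reduces  *)
(* to x n modulo p^n.                                                         *)
Definition coherent (p : nat) (x : nat -> int) : Prop :=
  forall n, x n = (x n.+1 %% (p ^ n)%N%:Z)%Z.

(* The primality proof is a parameter of the type because the integral domain *)
(* structure below needs it.                                                  *)
Record padic_int (p : nat) (p_pr : prime p) := PadicInt {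
  residue : nat -> int;
  residue_coherent : `[< coherent p residue >]
}.

Section PadicIntegers.
Variables (p : nat) (p_pr : prime p).
Local Notation Zp := (padic_int p_pr).
Local Notation "m == n %[modp k ]" := (m = n %[mod (p ^ k)%N%:Z])%Z
  (at level 70, n at next level).

HB.instance Definition _ := [isSub for @residue p p_pr].
HB.instance Definition _ := [Choice of Zp by <:].

Lemma residue_inj (x y : Zp) : (forall n, residue x n = residue y n) -> x = y.
Proof. by move=> exy; apply/val_inj/funext. Qed.

Lemma residueE (x : Zp) n : residue x n = (residue x n.+1 %% (p ^ n)%N%:Z)%Z.
Proof. by have /asboolP := residue_coherent x; apply. Qed.

Lemma residue_mod (x : Zp) n : (residue x n %% (p ^ n)%N%:Z)%Z = residue x n.
Proof. by rewrite residueE modz_mod. Qed.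

Lemma eqmod_dvdr (d : int) (k : nat) (m n : int) (e : int) :
  (d %| e)%Z -> (m = n %[mod e])%Z -> (m = n %[mod d])%Z.
Proof.
move=> de /eqP; rewrite eqz_mod_dvd => emn.
by apply/eqP; rewrite eqz_mod_dvd; apply: dvdz_trans de emn.
Qed.

Lemma eqmodS k m n : m == n %[modp k.+1] -> m == n %[modp k].
Proof. by apply: eqmod_dvdr => //; rewrite dvdzE /= dvdn_exp2l. Qed.

Lemma residueS (x : Zp) n : residue x n.+1 == residue x n %[modp n].
Proof. by rewrite [in RHS]residueE modz_mod. Qed.

Definition compatible (y : nat -> int) := forall n, y n.+1 == y n %[modp n].

Lemma reduce_coherent y : compatible y ->
  `[< coherent p (fun n => (y n %% (p ^ n)%N%:Z)%Z) >].
Proof.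
move=> hy; apply/asboolP => n.
by rewrite -hy; apply/esym/eqmodS; rewrite modz_mod.
Qed.

Definition of_residues y (hy : compatible y) : Zp :=
  PadicInt p_pr (reduce_coherent hy).

Lemma compatible_int (a : int) : compatible (fun=> a). Proof. by []. Qed.

Lemma compatible_opp (x : Zp) : compatible (fun n => - residue x n).
Proof. by move=> n; rewrite -modzNm residueS modzNm. Qed.

Lemma compatible_add (x y : Zp) :
  compatible (fun n => residue x n + residue y n).
Proof. by move=> n; rewrite -modzDm !residueS modzDm. Qed.

Lemma compatible_mul (x y : Zp) :
  compatible (fun n => residue x n * residue y n).
Proof. by move=> n; rewrite -modzMm !residueS modzMm. Qed.

Definition padic_int_of_int a := of_residues (compatible_int a).
Definition padic_int_opp x := of_residues (compatible_opp x).
Definition padic_int_add x y := of_residues (compatible_add x y).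
Definition padic_int_mul x y := of_residues (compatible_mul x y).
Local Notation of_int := padic_int_of_int.
Local Notation opp := padic_int_opp.
Local Notation add := padic_int_add.
Local Notation mul := padic_int_mul.

Fact padic_int_addA : associative add.
Proof.
by move=> x y z; apply: residue_inj => n /=; rewrite modzDmr modzDml addrA.
Qed.

Fact padic_int_addC : commutative add.
Proof. by move=> x y; apply: residue_inj => n /=; rewrite addrC. Qed.

Fact padic_int_add0 : left_id (of_int 0) add.
Proof.
by move=> x; apply: residue_inj => n /=; rewrite modzDml add0r residue_mod.
Qed.

Fact padic_int_addN : left_inverse (of_int 0) opp add.
Proof.
by move=> x; apply: residue_inj => n /=; rewrite modzDml addNr.
Qed.

HB.instance Definition _ := GRing.isZmodule.Build Zp
  padic_int_addA padic_int_addC padic_int_add0 padic_int_addN.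

Fact padic_int_mulA : associative mul.
Proof.
by move=> x y z; apply: residue_inj => n /=; rewrite modzMmr modzMml mulrA.
Qed.

Fact padic_int_mulC : commutative mul.
Proof. by move=> x y; apply: residue_inj => n /=; rewrite mulrC. Qed.

Fact padic_int_mul1 : left_id (of_int 1) mul.
Proof.
by move=> x; apply: residue_inj => n /=; rewrite modzMml mul1r residue_mod.
Qed.

Fact padic_int_mulDl : left_distributive mul add.
Proof.
move=> x y z; apply: residue_inj => n /=.
by rewrite modzMml modzDml modzDmr mulrDl.
Qed.

Fact padic_int_1_neq0 : of_int 1 != 0 :> Zp.
Proof.
apply/eqP => /(congr1 (fun x => residue x 1)) /=.
by rewrite expn1 mod0z modz_small // ltz_nat prime_gt1.
Qed.

HB.instance Definition _ := GRing.Zmodule_isComNzRing.Build Zp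
  padic_int_mulA padic_int_mulC padic_int_mul1 padic_int_mulDl
  padic_int_1_neq0.

Lemma residue0 n : residue (0 : Zp) n = 0.
Proof. by rewrite /= mod0z. Qed.

Lemma residueM (x y : Zp) n :
  residue (x * y) n = (residue x n * residue y n %% (p ^ n)%N%:Z)%Z.
Proof. by []. Qed.

Definition padic_int_unit : {pred Zp} := fun x => `[< exists y, y * x = 1 >].
Definition padic_int_inv (x : Zp) : Zp := xget x [set y | y * x = 1].

Fact padic_int_mulV : {in padic_int_unit, left_inverse 1 padic_int_inv *%R}.
Proof. by move=> x /asboolP x_unit; apply: (xgetPex x x_unit). Qed.

Fact padic_int_unitP (x y : Zp) : y * x = 1 -> x \in padic_int_unit.
Proof. by move=> yx1; apply/asboolP; exists y. Qed.

Fact padic_int_inv_out : {in [predC padic_int_unit], padic_int_inv =1 id}.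
Proof.
move=> x /negP x_nunit; apply: xgetPN => y yx1.
by apply: x_nunit; apply: padic_int_unitP yx1.
Qed.

HB.instance Definition _ := GRing.ComNzRing_hasMulInverse.Build Zp
  padic_int_mulV padic_int_unitP padic_int_inv_out.

(* The p-adic order of a nonzero element of Z_p is the n such that p^n        *)
(* divides x but p^n.+1 does not.  (At 0 the value is a junk 0.)              *)
Definition padic_int_ord (x : Zp) : nat :=
  xget 0%N [set n | residue x n = 0 /\ residue x n.+1 != 0].

Lemma padic_int_ordP (x : Zp) : x != 0 ->
  residue x (padic_int_ord x) = 0 /\ residue x (padic_int_ord x).+1 != 0.
Proof.
move=> x_neq0; apply: (@xgetPex _ _ [set n | residue x n = 0 /\ residue x n.+1 != 0]).
have [n xn] : exists n, residue x n != 0.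
  apply: contrapT => x0; move/eqP: x_neq0; apply; apply: residue_inj => n.
  by rewrite residue0; apply: contrapT => /eqP xn; apply: x0; exists n.
elim: n xn => [|n IHn] xn; first by rewrite residueE expn0 modz1 eqxx in xn.
by have [xn0|/IHn] := eqVneq (residue x n) 0; [exists n|].
Qed.

Lemma padic_int_ordE (x : Zp) n :
  (residue x n == 0) = (x == 0) || (n <= padic_int_ord x)%N.
Proof.
have [->|/padic_int_ordP[x_ord x_ordS]] := eqVneq x 0.
  by rewrite residue0 eqxx.
rewrite orFb.
have down k m : (k <= m)%N -> residue x m = 0 -> residue x k = 0.
  move=> /subnK <-; elim: (m - k)%N => // i IHi; rewrite addSn => xi.
  by apply: IHi; rewrite residueE xi mod0z.
have [le_n|lt_n] := leqP; first by rewrite (down _ _ le_n x_ord) eqxx.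
by apply/negbTE; apply: contra x_ordS => /eqP /(down _ _ lt_n) ->.
Qed.

Lemma residue_dvd (x : Zp) n k : (n <= k)%N ->
  (residue x n == 0) = ((p ^ n)%N %| `|residue x k|)%N.
Proof.
move=> /subnK <-; elim: (k - n)%N => [|i IHi].
  rewrite add0n -{1}residue_mod; apply/eqP/idP.
    by move/dvdz_mod0P; rewrite dvdzE.
  by move=> d; apply/dvdz_mod0P; rewrite dvdzE.
rewrite IHi addSn.
have := residueS x (i + n); move/eqP; rewrite eqz_mod_dvd => d.
have {}d : ((p ^ n)%N%:Z %| residue x (i + n).+1 - residue x (i + n))%Z.
  by apply: dvdz_trans d; rewrite dvdzE /= dvdn_exp2l // leq_addl.
rewrite -[LHS]/((p ^ n)%N%:Z %| _)%Z -[RHS]/((p ^ n)%N%:Z %| _)%Z.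
by rewrite -[residue x (i + n).+1](subrK (residue x (i + n))) rpredDl.
Qed.

Lemma padic_int_logn (x : Zp) k : x != 0 -> (padic_int_ord x < k)%N ->
  (0 < `|residue x k|)%N /\ logn p `|residue x k| = padic_int_ord x.
Proof.
move=> x_neq0 ltk.
have xk : residue x k != 0 by rewrite padic_int_ordE (negPf x_neq0) -ltnNge.
have xk0 : (0 < `|residue x k|)%N by rewrite absz_gt0.
split=> //; apply/eqP; rewrite eqn_leq.
rewrite leqNgt -!pfactor_dvdn // -!residue_dvd ?(ltnW ltk) //.
by rewrite !padic_int_ordE (negPf x_neq0) /= ltnn leqnn.
Qed.

Lemma padic_int_mul_ord (x y : Zp) : x != 0 -> y != 0 ->
  x * y != 0 /\ padic_int_ord (x * y) = (padic_int_ord x + padic_int_ord y)%N.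
Proof.
move=> x_neq0 y_neq0; set a := padic_int_ord x; set b := padic_int_ord y.
pose k := (a + b).+1.
have [xk la] : (0 < `|residue x k|)%N /\ logn p `|residue x k| = a.
  by apply: padic_int_logn => //; rewrite ltnS leq_addr.
have [yk lb] : (0 < `|residue y k|)%N /\ logn p `|residue y k| = b.
  by apply: padic_int_logn => //; rewrite ltnS leq_addl.
have key n : (n <= k)%N -> (residue (x * y) n == 0) = (n <= a + b)%N.
  move=> le_n; rewrite (residue_dvd _ le_n) residueM.
  rewrite -[LHS]/((p ^ n)%N%:Z %| _)%Z.
  have d : ((p ^ n)%N%:Z %|
      (residue x k * residue y k %% (p ^ k)%N%:Z)%Z - residue x k * residue y k)%Z.
    apply: (@dvdz_trans (p ^ k)%N%:Z); first by rewrite dvdzE /= dvdn_exp2l.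
    by rewrite -eqz_mod_dvd modz_mod.
  rewrite -[(_ %% _)%Z](subrK (residue x k * residue y k)) rpredDl //.
  by rewrite dvdzE abszM /= pfactor_dvdn ?muln_gt0 ?xk // lognM // la lb.
have xy : x * y != 0.
  apply/eqP => xy0; have := key k (leqnn k).
  by rewrite xy0 residue0 eqxx ltnn.
split=> //; apply/eqP; rewrite eqn_leq.
have := key _ (leqnSn (a + b)); have := key _ (leqnn k).
rewrite !padic_int_ordE (negPf xy) /= leqnn ltnn => /negbT.
by rewrite -ltnNge ltnS => -> ->.
Qed.

Fact padic_int_integral : GRing.integral_domain_axiom Zp.
Proof.
move=> x y /eqP xy0; apply: contraTT xy0.
by rewrite negb_or => /andP[x0 y0]; have [] := padic_int_mul_ord x0 y0.
Qed.

HB.instance Definition _ :=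
  GRing.ComUnitRing_isIntegral.Build Zp padic_int_integral.

End PadicIntegers.

Definition padic (p : nat) (p_pr : prime p) := {fraction (padic_int p_pr)}.

Section PadicNumbers.
Variables (p : nat) (p_pr : prime p).
Local Notation Zp := (padic_int p_pr).
Local Notation Qp := (padic p_pr).

HB.instance Definition _ := GRing.Field.on Qp.

Definition padic_of_int (a : Zp) : Qp := tofrac a.

Definition padic_integer : {pred Qp} :=
  fun x => `[< exists a : Zp, x = padic_of_int a >].

(* ord (a / b) = ord a - ord b; by [padic_ord_frac] the choice of the         *)
(* representative of the fraction is irrelevant.                              *)
Definition padic_ord (x : Qp) : int :=
  (padic_int_ord \n_(repr x))%:Z - (padic_int_ord \d_(repr x))%:Z.

Definition padic_norm (R : realType) (x : Qp) : R :=
  if x == 0 then 0 else p%:R ^ (- padic_ord x).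

Lemma padic_numden (x : Qp) :
  x = padic_of_int \n_(repr x) / padic_of_int \d_(repr x).
Proof.
have d0 : padic_of_int \d_(repr x) != 0 by rewrite tofrac_eq0 denom_ratioP.
apply: (canRL (mulfK d0)); rewrite -{1}[x]reprK /padic_of_int.
unlock FracField.tofrac; rewrite -[LHS]FracField.pi_mul; apply/eqmodP.
have d1 : \d_(repr x) != 0 by apply: denom_ratioP.
rewrite /= FracField.equivfE /FracField.mulf !numden_Ratio ?oner_neq0 ?mulr1 //.
by rewrite mulrC.
Qed.

Lemma padic_ord_frac (a b : Zp) : a != 0 -> b != 0 ->
  padic_ord (padic_of_int a / padic_of_int b)
  = (padic_int_ord a)%:Z - (padic_int_ord b)%:Z.
Proof.
move=> a0 b0; rewrite /padic_ord; set x := padic_of_int a / padic_of_int b.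
have Fb0 : padic_of_int b != 0 by rewrite tofrac_eq0.
have x0 : x != 0 by rewrite mulf_neq0 ?invr_eq0 ?tofrac_eq0.
have d0 : \d_(repr x) != 0 by apply: denom_ratioP.
have e : \n_(repr x) * b = a * \d_(repr x).
  apply/eqP; rewrite -tofrac_eq !tofracM -[tofrac a](divfK Fb0) -/x.
  by rewrite [X in _ == X * _ * _]padic_numden mulrAC divfK ?tofrac_eq0.
have n0 : \n_(repr x) != 0.
  apply: contra_neq a0 => n0; move/esym/eqP: e.
  by rewrite n0 mul0r mulf_eq0 (negPf d0) orbF => /eqP.
have [_ en] := padic_int_mul_ord n0 b0; have [_ ed] := padic_int_mul_ord a0 d0.
by apply/eqP; rewrite subr_eq addrAC eq_sym subr_eq -!PoszD -ed -e en.
Qed.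

End PadicNumbers.

Arguments padic_norm {p p_pr} R x.

Definition quasielliptic (p : nat) (p_pr : prime p) (n : nat)
    (f : {mpoly (padic p_pr)[n]}) (d : nat) (w : 'I_n -> nat) : Prop :=
  [/\ forall c : padic p_pr, f <> c%:MP,
      forall (a : padic p_pr) (xi : 'I_n -> padic p_pr), a != 0 ->
        f.@[fun i => a ^+ w i * xi i] = a ^+ d * f.@[xi]
    & forall xi : 'I_n -> padic p_pr, f.@[xi] = 0 <-> (forall i, xi i = 0)].

(* The weight Xi; note that 0 `^ a = 0 for a != 0.                            *)
Definition Xi (R : realType) (p : nat) (p_pr : prime p) (n d : nat)
    (w : 'I_n -> nat) (xi : 'I_n -> padic p_pr) : R :=
  \sum_(i < n) padic_norm R (xi i) `^ (d%:R / (w i)%:R).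

(* Main.v *)
Require Import Defs.
From HB Require Import structures.
From mathcomp Require Import all_boot all_order all_algebra.
From mathcomp Require Import boolp classical_sets reals exp.
From mathcomp Require Import mpoly.
From mathcomp Require Import filter ring.

Set Implicit Arguments.
Unset Strict Implicit.
Unset Printing Implicit Defensive.

Import Order.TTheory GRing.Theory Num.Theory.
Local Open Scope ring_scope.

(* Every nonzero xi can be written xi_i = p^(m w_i) y_i with all y_i in Z_p    *)
(* and ord y_i < w_i for some i.  Under this scaling both |f|_p and Xi are     *)
(* multiplied by p^(- m d), so it suffices to treat y.  There                  *)
(* p^-d <= Xi y <= n, and |f y|_p <= 1 since f has integral coefficients.      *)
(* A positive lower bound for |f y|_p holds by compactness: otherwise some     *)
(* sequence of such y has f y -> 0, and its limit along an ultrafilter is a    *)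
(* nonzero zero of f.                                                          *)

(** Having coefficients in Z_p, f restricts to a map [G] on Z_p^n that respects congruences modulo
    every p^k ([meval_padic_integer]); this is all the continuity needed. By (Q1),
    [scale_to_primitive] reduces the estimate to points y of Z_p^n with some y_i nonzero modulo
    p^(w_i). These form a compact set where f has no zero, by (Q2), so one k makes f(y) nonzero
    modulo p^k for all of them ([nonvanishing_residue]), whence |f(y)|_p >= p^-k. With |f(y)|_p <= 1
    and p^-d <= Xi(y) <= n ([Xi_of_int_ge], [Xi_of_int_le]) this gives both bounds. At the origin
    everything vanishes because d > 0 ([quasielliptic_degree_gt0]). *)

Section PadicIntTheory.
Variables (p : nat) (p_pr : prime p).
Local Notation Zp := (padic_int p_pr).

(** * Residues and divisibility in Z_p *)

Lemma residueD (x y : Zp) k :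
  residue (x + y) k = ((residue x k + residue y k) %% (p ^ k)%N%:Z)%Z.
Proof. by []. Qed.

Lemma residue_natr a k : residue (a%:R : Zp) k = (a%:Z %% (p ^ k)%N%:Z)%Z.
Proof.
elim: a => [|a IHa]; first by rewrite residue0 mod0z.
rewrite -natr1 residueD IHa.
have -> : residue (1 : Zp) k = (1%:Z %% (p ^ k)%N%:Z)%Z by [].
by rewrite modzDm -PoszD addn1.
Qed.

Lemma residue_eqmod (x : Zp) k m : (k <= m)%N ->
  (residue x m = residue x k %[mod (p ^ k)%N%:Z])%Z.
Proof.
move=> /subnK <-; elim: (m - k)%N => // i IHi; rewrite addSn -IHi.
by apply: (eqmod_dvdr 0 _ (residueS x _));
  rewrite dvdzE /= dvdn_exp2l ?leq_addl.
Qed.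

Lemma residueM_eq0 (x y : Zp) k : residue x k = 0 -> residue (x * y) k = 0.
Proof. by rewrite residueM => ->; rewrite mul0r mod0z. Qed.

Lemma residue_of_residues y (hy : compatible p y) k :
  residue (of_residues p_pr hy) k = (y k %% (p ^ k)%N%:Z)%Z.
Proof. by []. Qed.

(* With e = ord b, the congruence b c = a modulo p^(n+e+1) is solvable by     *)
(* Bezout and determines c modulo p^(n+1).                                    *)
Lemma padic_int_div (a b : Zp) : b != 0 ->
  (forall k, residue b k = 0 -> residue a k = 0) ->
  exists c : Zp, a = b * c.
Proof.
move=> b0 ab; set e := padic_int_ord b.
have lb n : (0 < `|residue b (n + e).+1|)%N /\
            logn p `|residue b (n + e).+1| = e.
  by apply: padic_int_logn; rewrite // ltnS leq_addl.
have /choice[c /= cP] n : exists c : int,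
    (residue b (n + e).+1 * c = residue a (n + e).+1
      %[mod (p ^ (n + e).+1)%N%:Z])%Z.
  have [bk lk] := lb n; set k := (n + e).+1 in bk lk *.
  have [u [v uv]] := Bezoutz (residue b k) (p ^ k)%N%:Z.
  (* The gcd is p^m with m <= e, so b, and hence a, vanishes modulo p^m. *)
  have g_dvd : (gcdz (residue b k) (p ^ k)%N%:Z %| residue a k)%Z.
    have /(dvdn_pfactor _ _ p_pr)[m _ gm] :
      (gcdn `|residue b k| (p ^ k) %| p ^ k)%N by rewrite dvdn_gcdr.
    have : (p ^ m %| `|residue b k|)%N by rewrite -gm dvdn_gcdl.
    rewrite pfactor_dvdn // lk => le_m.
    have mk : (m <= k)%N by rewrite (leq_trans le_m) // leqW ?leq_addl.
    rewrite /gcdz /= gm dvdzE /= -residue_dvd //.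
    by apply/eqP/ab/eqP; rewrite padic_int_ordE le_m orbT.
  have [q aq] := dvdzP g_dvd.
  exists (u * q); apply/eqP; rewrite eqz_mod_dvd; apply/dvdzP.
  by exists (- (q * v)); rewrite aq -uv; ring.
have cC : compatible p c.
  move=> n; have [bk lk] := lb n.
  apply: (@eqmod_dvdr _ 0 _ _ (p ^ n.+1)%N%:Z).
    by rewrite dvdzE dvdn_exp2l.
  set k := (n + e).+1 in bk lk; have cPn := cP n; rewrite -/k in cPn.
  have : ((p ^ k)%N%:Z %| residue b k * (c n.+1 - c n))%Z.
    rewrite mulrBr -eqz_mod_dvd cPn -(residue_eqmod a (leqnSn k)).
    have eS := eqmodS (cP n.+1); rewrite -eS.
    by rewrite -[in X in _ == X]modzMml (residue_eqmod b (leqnSn k)) modzMml.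
  move=> key; apply/eqP; move: key; rewrite eqz_mod_dvd.
  have [->|c_neq] := eqVneq (c n.+1) (c n); first by rewrite subrr dvdz0.
  have c0 : (0 < `|c n.+1 - c n|)%N by rewrite absz_gt0 subr_eq0.
  rewrite !dvdzE abszM !absz_nat !pfactor_dvdn ?muln_gt0 ?bk // lognM // lk.
  by rewrite /k addnC -addnS leq_add2l.
exists (of_residues p_pr cC); apply: residue_inj => n.
rewrite residueM residue_of_residues modzMmr.
have le_n : (n <= (n + e).+1)%N by rewrite leqW ?leq_addr.
rewrite -[LHS]residue_mod -(residue_eqmod a le_n).
have := cP n => /(eqmod_dvdr 0) => /(_ (p ^ n)%N%:Z) <-.
  by rewrite -modzMml (residue_eqmod b le_n) modzMml.
by rewrite dvdzE /= dvdn_exp2l.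
Qed.

Lemma padic_int_ord_p :
  padic_int_ord (p%:R : Zp) = 1%N /\ (p%:R : Zp) != 0.
Proof.
have r1 : residue (p%:R : Zp) 1 = 0 by rewrite residue_natr expn1 modzz.
have r2 : residue (p%:R : Zp) 2 != 0.
  rewrite residue_natr modz_small; first by rewrite eqz_nat -lt0n prime_gt0.
  by rewrite lez_nat ltz_nat /= -{1}(expn1 p) ltn_exp2l ?prime_gt1.
have p0 : (p%:R : Zp) != 0.
  by apply: contraNneq r2 => ->; rewrite residue0.
split=> //; move/eqP: r1; move: r2.
rewrite !padic_int_ordE (negPf p0) /= -ltnNge ltnS => le1 ge1.
by apply/eqP; rewrite eqn_leq le1.
Qed.


(** * Compactness of Z_p, by ultrafilters *)

Lemma ultra_bounded T (U : set_system T) (h : T -> nat) b : UltraFilter U ->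
  U [set t | (h t < b)%N]%classic -> exists m, U [set t | h t = m]%classic.
Proof.
move=> UU; elim: b => [|b IHb] Ub.
  by have [t //] := filter_ex Ub.
(* [U] contains the level set of the value b or its complement; the latter lowers the bound. *)
have [Ueq|Uneq] := in_ultra_setVsetC [set t | h t = b]%classic UU.
  by exists b.
apply: IHb; apply: filterS2 Ub Uneq => t /=.
by rewrite ltnS leq_eqVlt => /predU1P[-> []|].
Qed.

(** There are finitely many residues modulo p^k, so one of them is taken on a set of [U]. These
    choices cohere because two sets of [U] always meet. *)
Lemma padic_int_ultralimit T (U : set_system T) (x : T -> Zp) : UltraFilter U ->
  exists a : Zp, forall k, U [set t | residue (x t) k = residue a k]%classic.
Proof.
move=> UU.
have pk_gt0 k : 0 < (p ^ k)%N%:Z by rewrite ltz_nat expn_gt0 prime_gt0.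
have res_ge0 y k : 0 <= residue (y : Zp) k.
  by rewrite -residue_mod modz_ge0 // gt_eqF.
have /choice[r rP] k : exists r : nat,
    U [set t | `|residue (x t) k|%N = r]%classic.
  apply: (@ultra_bounded _ _ _ (p ^ k)); apply: filterS filterT => t _ /=.
  by rewrite -ltz_nat gez0_abs // -residue_mod ltz_pmod.
have rC : `[< coherent p (fun k => (r k)%:Z) >].
  apply/asboolP => k.
  have [t [<- <-]] := filter_ex (filterI (rP k) (rP k.+1)).
  by rewrite !gez0_abs // -residueE.
exists (PadicInt p_pr rC) => k; apply: filterS (rP k) => t /= <-.
by rewrite gez0_abs.
Qed.

Section CongruentMap.
Variables (n : nat) (G : ('I_n -> Zp) -> Zp).
Hypothesis G_congr : forall k x y,
  (forall i, residue (x i) k = residue (y i) k) ->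
  residue (G x) k = residue (G y) k.

(** Otherwise each level t has a counterexample x_t. An ultrafilter containing all tails gives a
    limit a with [G a = 0], so a = 0; yet a agrees modulo the p^(w i) with some x_t, which has a
    coordinate nonzero there. *)
Lemma nonvanishing_residue (w : 'I_n -> nat) :
    (forall x, G x = 0 -> forall i, x i = 0) ->
  exists k, forall x i, residue (x i) (w i) != 0 -> residue (G x) k != 0.
Proof.
move=> G_nz; apply: contrapT => noK.
have /choice[x xP] k : exists x,
    (exists i, residue (x i) (w i) != 0) /\ residue (G x) k = 0.
  apply: contrapT => nok; apply: noK; exists k => x i xi.
  by apply/eqP => Gx; apply: nok; exists x; split=> //; exists i.
have [U [UU oU]] := ultraFilterLemma eventually_filter.
have /choice[a aP] i : exists a : Zp,
    forall k, U [set t | residue (x t i) k = residue a k]%classic.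
  exact: padic_int_ultralimit.
have near_a (h : 'I_n -> nat) :
    U [set t | forall i, residue (x t i) (h i) = residue (a i) (h i)]%classic.
  by apply: filter_forall => i; apply: aP.
have Ga0 : G a = 0.
  apply: residue_inj => k; rewrite residue0.
  have Uk : U [set t | (k <= t)%N]%classic by apply: oU; exists k.
  have [t [/= ext le_kt]] := filter_ex (filterI (near_a (fun=> k)) Uk).
  rewrite -(G_congr ext) -residue_mod -(residue_eqmod _ le_kt).
  by rewrite (proj2 (xP t)) mod0z.
have [t /= ext] := filter_ex (near_a w).
have [[i]] := xP t.
by rewrite ext (G_nz _ Ga0) residue0 eqxx.
Qed.

End CongruentMap.
End PadicIntTheory.

Section PadicTheory.
Variables (p : nat) (p_pr : prime p).
Local Notation Zp := (padic_int p_pr).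
Local Notation Qp := (padic p_pr).

(** * Order and integrality in Q_p *)

Lemma padic_of_int_eq0 (a : Zp) : (padic_of_int a == 0) = (a == 0).
Proof. exact: tofrac_eq0. Qed.

Lemma padic_num_neq0 (x : Qp) : x != 0 -> \n_(repr x) != 0.
Proof.
apply: contra_neq => n0.
by rewrite [x]padic_numden n0 /padic_of_int tofrac0 mul0r.
Qed.

Lemma padic_ordM (x y : Qp) : x != 0 -> y != 0 ->
  padic_ord (x * y) = padic_ord x + padic_ord y.
Proof.
move=> x0 y0; rewrite [x in x * _]padic_numden [y in _ * y]padic_numden.
rewrite mulf_div /padic_of_int -!tofracM.
have [n0 en] := padic_int_mul_ord (padic_num_neq0 x0) (padic_num_neq0 y0).
have [d0 ed] :=
  padic_int_mul_ord (denom_ratioP (repr x)) (denom_ratioP (repr y)).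
by rewrite padic_ord_frac // en ed /padic_ord !PoszD; ring.
Qed.

Lemma padic_int_ord1 : padic_int_ord (1 : Zp) = 0%N.
Proof.
have [_] := padic_int_mul_ord (oner_neq0 Zp) (oner_neq0 Zp).
by rewrite mulr1 -[LHS]addn0 => /addnI.
Qed.

Lemma padic_ord_of_int (a : Zp) : a != 0 ->
  padic_ord (padic_of_int a) = (padic_int_ord a)%:Z.
Proof.
move=> a0; rewrite -[padic_of_int a]divr1 -[1](tofrac1 Zp).
by rewrite padic_ord_frac ?oner_neq0 // padic_int_ord1 subr0.
Qed.

Lemma padic_ordX (x : Qp) k : x != 0 -> padic_ord (x ^+ k) = padic_ord x *+ k.
Proof.
move=> x0; elim: k => [|k IHk].
  by rewrite expr0 mulr0n -(tofrac1 Zp) padic_ord_of_int ?oner_neq0 //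
             padic_int_ord1.
by rewrite exprS padic_ordM ?expf_neq0 // IHk mulrS.
Qed.

Lemma padic_ord_surj (m : int) : exists2 x : Qp, x != 0 & padic_ord x = m.
Proof.
have [ord_p p0] := padic_int_ord_p p_pr.
have pX0 k : (p%:R : Zp) ^+ k != 0 by rewrite expf_neq0.
have ord_pX k : padic_int_ord ((p%:R : Zp) ^+ k) = k.
  elim: k => [|k IHk]; first by rewrite expr0 padic_int_ord1.
  have [_ e] := padic_int_mul_ord p0 (pX0 k).
  by rewrite exprS e IHk ord_p.
have key a b : exists2 x : Qp, x != 0 & padic_ord x = a%:Z - b%:Z.
  exists (padic_of_int (p%:R ^+ a) / padic_of_int (p%:R ^+ b)).
    by rewrite mulf_neq0 ?invr_eq0 ?padic_of_int_eq0.
  by rewrite padic_ord_frac // !ord_pX.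
case: m => m; first by have := key m 0%N; rewrite subr0.
by have := key 0%N m.+1; rewrite sub0r -NegzE.
Qed.

(** The numerator has order at least that of the denominator, so [padic_int_div] performs the
    division in Z_p. *)
Lemma padic_integer_ord_ge0 (x : Qp) : x != 0 -> 0 <= padic_ord x ->
  exists a : Zp, x = padic_of_int a.
Proof.
move=> x0 ge0; have d0 : \d_(repr x) != 0 := denom_ratioP (repr x).
have [c nc] : exists c, \n_(repr x) = \d_(repr x) * c.
  apply: padic_int_div => // k /eqP dk; apply/eqP; move: dk.
  rewrite !padic_int_ordE (negPf d0) (negPf (padic_num_neq0 x0)) /=.
  by move=> /leq_trans; apply; rewrite -lez_nat -subr_ge0.
exists c; have := padic_numden x; rewrite nc /padic_of_int tofracM.
by rewrite [tofrac _ * _]mulrC mulfK ?tofrac_eq0.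
Qed.

(** * The p-adic norm *)

Variable R : realType.
Local Notation norm := (@padic_norm p p_pr R).

Let pR_gt0 : 0 < p%:R :> R.
Proof. by rewrite ltr0n prime_gt0. Qed.

Lemma padic_normE (x : Qp) : x != 0 -> norm x = p%:R ^ (- padic_ord x).
Proof. by rewrite /padic_norm => /negPf ->. Qed.

Lemma padic_norm_gt0 (x : Qp) : x != 0 -> 0 < norm x.
Proof. by move=> /padic_normE ->; rewrite exprz_gt0. Qed.

Lemma padic_norm0 : norm 0 = 0.
Proof. by rewrite /padic_norm eqxx. Qed.

Lemma padic_norm_ge0 (x : Qp) : 0 <= norm x.
Proof.
by have [->|/padic_norm_gt0/ltW //] := eqVneq x 0; rewrite padic_norm0.
Qed.

Lemma padic_normM (x y : Qp) : norm (x * y) = norm x * norm y.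
Proof.
have [->|x0] := eqVneq x 0; first by rewrite mul0r padic_norm0 mul0r.
have [->|y0] := eqVneq y 0; first by rewrite mulr0 padic_norm0 mulr0.
rewrite (padic_normE x0) (padic_normE y0) (padic_normE (mulf_neq0 x0 y0)).
by rewrite (padic_ordM x0 y0) opprD expfzDr // gt_eqF.
Qed.

Lemma padic_normX (x : Qp) k : x != 0 -> norm (x ^+ k) = norm x ^+ k.
Proof.
move=> x0; elim: k => [|k IHk]; last by rewrite !exprS padic_normM IHk.
by rewrite padic_normE ?expf_neq0 // (padic_ordX 0 x0) mulr0n oppr0.
Qed.

Lemma padic_norm_of_int_le1 (a : Zp) : norm (padic_of_int a) <= 1.
Proof.
have [->|a0] := eqVneq a 0; first by rewrite /padic_of_int tofrac0 padic_norm0.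
rewrite padic_normE ?padic_of_int_eq0 // padic_ord_of_int // -invr_expz.
by rewrite invf_le1 ?exprn_gt0 // exprn_ege1 // ler1n prime_gt0.
Qed.

Lemma padic_norm_of_int_ge (a : Zp) k : residue a k != 0 ->
  p%:R ^- k <= norm (padic_of_int a).
Proof.
rewrite padic_int_ordE negb_or -ltnNge => /andP[a0 lt_k].
rewrite padic_normE ?padic_of_int_eq0 // padic_ord_of_int // -invr_expz.
rewrite lef_pV2 ?posrE ?exprn_gt0 //.
by rewrite ler_weXn2l ?ler1n ?prime_gt0 // ltnW.
Qed.

(** * Integral polynomials as congruence-preserving maps *)

Lemma meval_padic_integer n (f : {mpoly Qp[n]}) :
    f \is a mpolyOver n (@padic_integer p p_pr) ->
  exists G : ('I_n -> Zp) -> Zp,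
    (forall x, f.@[fun i => padic_of_int (x i)] = padic_of_int (G x)) /\
    (forall k x y, (forall i, residue (x i) k = residue (y i) k) ->
       residue (G x) k = residue (G y) k).
Proof.
rewrite qualifE /= => /allP f_int.
have /choice[c cP] m : exists a : Zp, m \in msupp f -> f@_m = padic_of_int a.
  have [m_supp|_] := boolP (m \in msupp f); last by exists 0.
  by have /asboolP[a ->] := f_int _ (map_f _ m_supp); exists a.
(* The same polynomial with coefficients lifted to Z_p; sums and products respect congruences. *)
exists (fun x => \sum_(m <- msupp f) c m * \prod_i x i ^+ m i).
split=> [x|k x y xy].
  rewrite mevalE /padic_of_int rmorph_sum; apply: eq_big_seq => m m_supp.
  rewrite rmorphM rmorph_prod (cP m m_supp); congr (_ * _).
  by apply: eq_bigr => i _; rewrite rmorphXn.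
pose congr_k (u v : Zp) := residue u k = residue v k.
have congrM u u' v v' :
    congr_k u u' -> congr_k v v' -> congr_k (u * v) (u' * v').
  by rewrite /congr_k !residueM => -> ->.
have congrX u v j : congr_k u v -> congr_k (u ^+ j) (v ^+ j).
  by move=> uv; elim: j => [|j IHj] //; rewrite !exprS; apply: congrM.
apply: (@big_ind2 _ _ congr_k) => // [u u' v v'|m _].
  by rewrite /congr_k !residueD => -> ->.
apply: (congrM) => //; apply: (@big_ind2 _ _ congr_k) => // i _.
exact: congrX (xy i).
Qed.

(** * The weight Xi and weighted scaling *)

Lemma Xi_of_int_le n d (w : 'I_n -> nat) (y : 'I_n -> Zp) :
  Xi R d w (fun i => padic_of_int (y i)) <= n%:R.
Proof.
rewrite -[n in leRHS]card_ord -sumr_const; apply: ler_sum => i _.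
have e : 1 = 1 `^ (d%:R / (w i)%:R) :> R by rewrite powR1.
rewrite [leRHS]e ge0_ler_powR ?nnegrE ?padic_norm_ge0 //.
  by rewrite divr_ge0.
exact: padic_norm_of_int_le1.
Qed.

(** The i-th term alone suffices: its norm is at least p^(- w i), and the exponent d / w i turns
    this into p^-d. *)
Lemma Xi_of_int_ge n d (w : 'I_n -> nat) (y : 'I_n -> Zp) i :
    (0 < w i)%N -> residue (y i) (w i) != 0 ->
  p%:R ^- d <= Xi R d w (fun i => padic_of_int (y i)).
Proof.
move=> w_gt0 yi; rewrite /Xi (bigD1 i) //=.
apply: ler_wpDr; first by apply: sumr_ge0 => j _; apply: powR_ge0.
have -> : p%:R ^- d = (p%:R ^- w i : R) `^ (d%:R / (w i)%:R).
  rewrite -!exprVn -!powR_mulrn ?invr_ge0 // -powRrM; congr (_ `^ _).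
  by rewrite mulrC divfK // pnatr_eq0 -lt0n.
rewrite ge0_ler_powR ?nnegrE ?padic_norm_ge0 ?divr_ge0 ?invr_ge0 ?exprn_ge0 //.
exact: padic_norm_of_int_ge.
Qed.

Lemma Xi_scale n d (w : 'I_n -> nat) (x : 'I_n -> Qp) (a : Qp) :
    (forall i, (0 < w i)%N) -> a != 0 ->
  Xi R d w (fun i => a ^+ w i * x i) = norm a ^+ d * Xi R d w x.
Proof.
move=> w_gt0 a0; rewrite /Xi mulr_sumr; apply: eq_bigr => i _.
have na := padic_norm_gt0 a0.
rewrite padic_normM padic_normX // powRM ?exprn_ge0 ?padic_norm_ge0 //.
rewrite -powR_mulrn ?padic_norm_ge0 // -powRrM [_ * (d%:R / _)]mulrC.
rewrite divfK ?pnatr_eq0 -?lt0n //.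
by rewrite powR_mulrn ?padic_norm_ge0.
Qed.

(* The scaling exponent is the largest m with m (w i) <= ord (x i) for all i, *)
(* i.e. the minimum of the integer parts of ord (x i) / w i.                  *)
Lemma scale_to_primitive n (w : 'I_n -> nat) (x : 'I_n -> Qp) :
    (forall i, (0 < w i)%N) -> (exists i, x i != 0) ->
  exists a : Qp, exists y : 'I_n -> Zp,
    [/\ a != 0, (forall i, x i = a ^+ w i * padic_of_int (y i))
      & exists i, residue (y i) (w i) != 0].
Proof.
move=> w_gt0 [i0 xi0].
pose q i := (padic_ord (x i) %/ (w i)%:Z)%Z.
(* Zero coordinates are left out: [padic_ord] is a finite junk value at 0, not infinity. *)
case: (@arg_minP _ _ _ i0 (fun i => x i != 0) q xi0) => j xj jmin.
have [a a0 ord_a] := padic_ord_surj (q j).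
have wZ i : 0 < (w i)%:Z by rewrite ltz_nat.
have aw0 i : a ^+ w i != 0 by rewrite expf_neq0.
have y0 i : x i != 0 -> x i / a ^+ w i != 0.
  by move=> xi; apply: mulf_neq0 xi (invr_neq0 (aw0 i)).
have ord_y i : x i != 0 ->
    padic_ord (x i / a ^+ w i) = padic_ord (x i) - q j * (w i)%:Z.
  move=> xi; have := padic_ordM (y0 i xi) (aw0 i).
  rewrite (divfK (aw0 i)) (padic_ordX _ a0) ord_a -mulr_natr natz => ->.
  by rewrite addrK.
have /choice[y yP] i : exists b : Zp, x i / a ^+ w i = padic_of_int b.
  have [->|xi] := eqVneq (x i) 0.
    by exists 0; rewrite mul0r /padic_of_int tofrac0.
  apply: padic_integer_ord_ge0; first exact: y0.
  rewrite ord_y // subr_ge0 -lez_divRL //; exact: jmin.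
exists a, y; split; first exact: a0.
  by move=> i; rewrite -yP mulrC (divfK (aw0 i)).
exists j; have yj0 : y j != 0.
  by rewrite -padic_of_int_eq0 -yP y0.
(* At the minimizing j, the order of y_j is the remainder of ord (x j) by w j, hence less than w
   j. *)
rewrite padic_int_ordE (negPf yj0) -ltnNge -ltz_nat -padic_ord_of_int // -yP.
by rewrite ord_y // ltrBlDl -[X in _ + X]mul1r -mulrDl; apply: ltz_ceil.
Qed.

(** * Quasielliptic polynomials on integral points *)

Section Quasielliptic.
Variables (n d : nat) (f : {mpoly Qp[n]}) (w : 'I_n -> nat).
Variable G : ('I_n -> Zp) -> Zp.
Hypothesis w_gt0 : forall i, (0 < w i)%N.
Hypothesis f_qe : quasielliptic f d w.
Hypothesis fG : forall x,
  f.@[fun i => padic_of_int (x i)] = padic_of_int (G x).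
Hypothesis G_congr : forall k x y,
  (forall i, residue (x i) k = residue (y i) k) ->
  residue (G x) k = residue (G y) k.

Lemma quasielliptic_int_eq0 x : G x = 0 <-> forall i, x i = 0.
Proof.
have [_ _ /(_ (fun i => padic_of_int (x i))) f0] := f_qe; split=> [Gx0 i|x0].
  apply/eqP; rewrite -padic_of_int_eq0; apply/eqP; move: i; apply/f0.
  by rewrite fG Gx0; apply: tofrac0.
apply/eqP; rewrite -padic_of_int_eq0 -fG; apply/eqP/f0 => i.
by rewrite x0; apply: tofrac0.
Qed.

(* If d = 0 then f(1, .., 1) = f(p^(j w_1), .., p^(j w_n)) tends to f(0) = 0. *)
Lemma quasielliptic_degree_gt0 : 'I_n -> (0 < d)%N.
Proof.
move=> i; rewrite lt0n; apply/eqP => d0.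
have [_ f_hom _] := f_qe.
have [_ p0] := padic_int_ord_p p_pr.
suff /quasielliptic_int_eq0/(_ i)/eqP : G (fun=> 1) = 0 by rewrite oner_eq0.
apply: residue_inj => j.
have -> : G (fun=> 1) = G (fun i => (p%:R ^+ j) ^+ w i).
  apply/eqP; rewrite -tofrac_eq -!/(padic_of_int _) -!fG; apply/eqP.
  have pj0 : padic_of_int ((p%:R : Zp) ^+ j) != 0.
    by rewrite padic_of_int_eq0 expf_neq0.
  have := f_hom _ (fun=> 1) pj0; rewrite d0 expr0 mul1r => f1.
  have -> : (fun _ : 'I_n => padic_of_int (1 : Zp)) = fun=> 1.
    by apply: funext => _; apply: tofrac1.
  rewrite -f1; congr (f.@[_]); apply: funext => l.
  by rewrite mulr1 /padic_of_int [RHS]rmorphXn.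
have <- : G (fun=> 0) = 0 by apply/quasielliptic_int_eq0.
(* As w_l >= 1, p^(j w_l) vanishes modulo p^j. *)
apply: G_congr => l; rewrite residue0 -(prednK (w_gt0 l)) exprS.
by apply: residueM_eq0; rewrite -natrX residue_natr modzz.
Qed.

End Quasielliptic.
End PadicTheory.

Theorem theorem3p10 (R : realType) (p : nat) (p_pr : prime p) (n : nat)
    (f : {mpoly (padic p_pr)[n]}) (d : nat) (w : 'I_n -> nat)
    (f_int : f \is a mpolyOver n (@padic_integer p p_pr))
    (w_gt0 : forall i, (0 < w i)%N)
    (f_qe : quasielliptic f d w) :
  exists A0 A1 : R, [/\ 0 < A0, 0 < A1 &
    forall xi : 'I_n -> padic p_pr,
      A0 * Xi R d w xi <= padic_norm R f.@[xi] <= A1 * Xi R d w xi].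
Proof.
have [G [fG G_congr]] := meval_padic_integer f_int.
have G_eq0 := quasielliptic_int_eq0 f_qe fG.
have d_gt0 := quasielliptic_degree_gt0 w_gt0 f_qe fG G_congr.
have [_ f_hom f_eq0] := f_qe.
have [k kP] := nonvanishing_residue G_congr w (fun x => proj1 (G_eq0 x)).
have pX_gt0 j : 0 < p%:R ^+ j :> R by rewrite exprn_gt0 // ltr0n prime_gt0.
(* These come from p^-k <= |f(y)|_p with Xi(y) <= n, and from |f(y)|_p <= 1 with p^-d <= Xi(y); n +
   1 keeps the denominator nonzero. *)
exists (p%:R ^- k / n.+1%:R), (p%:R ^+ d).
split=> [||x]; [by rewrite divr_gt0 ?invr_gt0|by []|].
have [x0|/existsNP[i /eqP xi]] := pselect (forall i, x i = 0).
  rewrite (proj2 (f_eq0 x) x0) padic_norm0 /Xi big1 ?mulr0 ?lexx // => i _.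
  (* [powR] sends 0 to 1 at exponent 0, so d > 0 matters here. *)
  rewrite x0 padic_norm0 powR0 //.
  by rewrite mulf_neq0 ?invr_eq0 ?pnatr_eq0 -?lt0n ?d_gt0.
have [a [y [a0 xE [j yj]]]] := scale_to_primitive w_gt0 (ex_intro _ i xi).
have {xE} -> : x = fun i => a ^+ w i * padic_of_int (y i) by apply: funext.
rewrite (f_hom a _ a0) fG padic_normM padic_normX // Xi_scale //.
(* All three members carry the factor |a|_p^d, which cancels. *)
rewrite ![_ * (padic_norm R a ^+ d * _)]mulrCA.
rewrite !ler_pM2l ?exprn_gt0 ?padic_norm_gt0 //.
apply/andP; split.
  apply: le_trans (padic_norm_of_int_ge R (kP y j yj)).
  rewrite -mulrA ler_piMr ?invr_ge0 ?(ltW (pX_gt0 k)) //.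
  rewrite mulrC ler_pdivrMr ?ltr0Sn // mul1r.
  by rewrite (le_trans (Xi_of_int_le _ _ _ _)) // ler_nat.
apply: le_trans (padic_norm_of_int_le1 _ _) _.
rewrite mulrC -ler_pdivrMr // div1r.
exact: Xi_of_int_ge yj.
Qed.
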